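(* For every integer $k\ge 1$ there is $\varepsilon_k>0$ such that every nonempty $\mathcal{O}_k$-free graph $G$ of girth at least 11 has a vertex $x$ with $\deg_G(x)\ge \varepsilon_k\cdot r(G)$.
   Context: All graphs are finite and simple. The cycle rank of $G$ is $r(G)=|E(G)|-|V(G)|+|\mathcal{C}(G)|$, where $\mathcal{C}(G)$ is the set of connected components of $G$. Two vertex-disjoint subgraphs are independent if there is no edge between them. A graph $G$ is $\mathcal{O}_k$-free if it does not contain $k$ pairwise vertex-disjoint and pairwise independent cycles; equivalently, $G$ has no induced subgraph isomorphic to a disjoint union of $k$ cycles. The girth is the minimum length of a cycle (infinite for forests). *)

(* Defs.v *)
From HB Require Import structures.
From mathcomp Require Import all_boot all_order all_algebra.
Set Implicit Arguments. Unset Strict Implicit. Unset Printing Implicit Defensive.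
Import Order.TTheory GRing.Theory Num.Theory.

Section Graph.
Variables (T : finType) (e : rel T).

Definition simple_graph : Prop := symmetric e /\ irreflexive e.

Definition edge_set : {set {set T}} :=
  [set A : {set T} | [exists x, exists y, e x y && (A == [set x; y])]].

Definition components : {set {set T}} :=
  [set [set y | connect e x y] | x : T].

Definition cycle_rank : int :=
  (#|edge_set|%:Z - #|T|%:Z + #|components|%:Z)%R.

Definition deg (x : T) : nat := #|[set y | e x y]|.

Definition is_graph_cycle (s : seq T) : bool :=
  [&& 3 <= size s, uniq s & cycle e s].

Definition girth_at_least (g : nat) : Prop :=
  forall s : seq T, is_graph_cycle s -> g <= size s.

Definition has_k_indep_cycles (k : nat) : Prop :=
  exists c : 'I_k -> seq T,
    (forall i, is_graph_cycle (c i)) /\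
    (forall i j, i != j ->
       (forall x, x \in c i -> x \notin c j) /\
       (forall x y, x \in c i -> y \in c j -> ~~ e x y)).

Definition O_free (k : nat) : Prop := ~ has_k_indep_cycles k.

End Graph.

(* Main.v *)
(** Work with [f V = 2|E(G[V])| - 2|V|], which up to the number of cyclic components is twice the cycle rank, and argue by induction on [k] that [f V > 2 M D] forces [k] independent cycles when all degrees are at most [D]. A minimal such [V] has minimum degree at least 2, so [f V] is the sum of the excesses [deg - 2]. Since two vertices have at most one common neighbour (this is all that is used of the girth), Bonferroni shows that only about [sqrt M] vertices see an excess of [sqrt M * D] or more in their neighbourhood; delete them. Now explore from a vertex [v] whose neighbourhood has the largest excess [Q], measuring distance by the number of vertices of degree at least 3: as long as no cycle closes up, the explored set is a tree whose excess doubles at each level. Hence some cycle [Z] has only [O(log (f V / Q))] vertices of degree at least 3, its closed neighbourhood carries an excess of only [O(Q log (f V / Q))], and deleting that neighbourhood leaves at least half of [f V]; the induction hypothesis applies to what is left. *)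
Require Import Defs.
From mathcomp Require Import all_boot all_order all_algebra.
From mathcomp Require Import zify.
Set Implicit Arguments. Unset Strict Implicit. Unset Printing Implicit Defensive.

Lemma sum_setU (T : finType) (A B : {set T}) (F : T -> nat) : [disjoint A & B] ->
  \sum_(x in A :|: B) F x = \sum_(x in A) F x + \sum_(x in B) F x.
Proof. by move=> dAB; rewrite -bigU //; apply: eq_bigl => x; rewrite !inE. Qed.

(** * Degrees, edge counts and cores of minimum degree 2 *)

Section Counting.
Variables (T : finType) (e : rel T).
Hypotheses (esym : symmetric e) (eirr : irreflexive e).
Implicit Types (A B U V X : {set T}) (x y u v : T) (s : seq T).

(* Edges are counted as ordered pairs: [es A A] is twice the number of edges inside [A]. *)
Definition dg A x : nat := \sum_(y in A) e x y.
Definition es A B : nat := \sum_(x in A) dg B x.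

Lemma dgE A x : dg A x = #|[set y in A | e x y]|.
Proof.
rewrite /dg -sum1_card big_mkcond [RHS]big_mkcond; apply: eq_bigr => y _.
by rewrite inE; case: (y \in A); case: (e x y).
Qed.

Lemma dgU A B x : [disjoint A & B] -> dg (A :|: B) x = dg A x + dg B x.
Proof. by move=> dAB; rewrite /dg sum_setU. Qed.

Lemma dgS A B x : A \subset B -> dg A x <= dg B x.
Proof.
move=> sAB; rewrite !dgE subset_leq_card //; apply/subsetP=> y.
by rewrite !inE => /andP[/(subsetP sAB)-> ->].
Qed.

Lemma esC A B : es A B = es B A.
Proof.
rewrite /es /dg exchange_big /=; apply: eq_bigr => x _; apply: eq_bigr => y _.
by rewrite esym.
Qed.

Lemma esUl A B V : [disjoint A & B] -> es (A :|: B) V = es A V + es B V.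
Proof. by move=> dAB; rewrite /es sum_setU. Qed.

Lemma esUr A B V : [disjoint A & B] -> es V (A :|: B) = es V A + es V B.
Proof. by move=> dAB; rewrite esC esUl // !(esC V). Qed.

Lemma esS A B V : A \subset B -> es V A <= es V B.
Proof. by move=> sAB; apply: leq_sum => x _; apply: dgS. Qed.

Lemma setUDK A V : A \subset V -> V = A :|: V :\: A.
Proof. by move=> sAV; rewrite -{1}(setID V A) (setIidPr sAV). Qed.

Lemma disjD A V : [disjoint A & V :\: A].
Proof. by rewrite -setI_eq0; apply/eqP/setP=> x; rewrite !inE; case: (x \in A). Qed.

(** Inclusion-exclusion: [2 * es A V] counts the pairs meeting [A], those inside [A] twice. *)
Lemma es_remove A V : A \subset V ->
  es V V + es A A = es (V :\: A) (V :\: A) + 2 * es A V.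
Proof.
move=> sAV; have dA := disjD A V; have EV := setUDK sAV.
have -> : es V V = es A V + es (V :\: A) V by rewrite {1}EV esUl.
have -> : es (V :\: A) V = es (V :\: A) A + es (V :\: A) (V :\: A)
  by rewrite {2}EV esUr.
have -> : es A V = es A A + es A (V :\: A) by rewrite {1}EV esUr.
rewrite (esC (V :\: A) A); lia.
Qed.

Lemma dg_edge A x y : y \in A -> e x y -> 0 < dg A x.
Proof. by move=> Ay exy; rewrite dgE; apply/card_gt0P; exists y; rewrite inE Ay. Qed.

Lemma dg_gt0 A x : 0 < dg A x -> exists2 y, y \in A & e x y.
Proof. by rewrite dgE => /card_gt0P[y]; rewrite inE => /andP[]; exists y. Qed.

Lemma dg_gt1 A x : 1 < dg A x ->
  exists y z, [/\ y \in A, z \in A, y != z, e x y & e x z].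
Proof.
rewrite dgE => /card_gt1P[y [z []]]; rewrite !inE => /andP[Ay xy] /andP[Az xz] yz.
by exists y, z.
Qed.

Lemma ge2_dg A x y z : y \in A -> z \in A -> y != z -> e x y -> e x z -> 1 < dg A x.
Proof.
by move=> Ay Az yz xy xz; rewrite dgE; apply/card_gt1P; exists y, z; rewrite !inE Ay Az.
Qed.

(** Delete vertices while the density bound survives. Deleting [x] changes [es A A - 2 * #|A|] by
    [2 - 2 * dg A x], so once no deletion is possible every degree is at least 2 and the excess is
    within [2 * D] of [N]. *)
Lemma dense_core V N D : V != set0 -> (forall x, x \in V -> dg V x <= D) ->
  2 * #|V| + N <= es V V ->
  exists A, [/\ A != set0, A \subset V, forall x, x \in A -> 2 <= dg A x,
    2 * #|A| + N <= es A A & es A A + 3 <= 2 * #|A| + N + 2 * D].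
Proof.
elim: {V}_.+1 {-2}V (ltnSn #|V|) => // n IH V leV V0 degV dV.
have small x : x \in V -> es V V = es (V :\ x) (V :\ x) + 2 * dg V x.
  move=> Vx; have := @es_remove [set x] V; rewrite sub1set => /(_ Vx).
  by rewrite /es !big_set1 /dg big_set1 eirr addn0.
case: (boolP [exists x in V, (V :\ x != set0) &&
                (2 * #|V :\ x| + N <= es (V :\ x) (V :\ x))]).
  move=> /exists_inP[x Vx /andP[Vx0 dVx]]; have sV : V :\ x \subset V by apply: subD1set.
  case: (IH (V :\ x)) => //.
  - by move: leV; rewrite (cardsD1 x) Vx.
  - by move=> y /(subsetP sV) /degV; apply: leq_trans; apply: dgS.
  by move=> A [A0 sA *]; exists A; split => //; apply: subset_trans sV.
move=> /exists_inPn nV.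
have bnd x : x \in V -> es V V + 3 <= 2 * #|V| + N + 2 * dg V x.
  move=> Vx; have := nV x Vx; have := small x Vx.
  have cV : #|V| = #|V :\ x|.+1 by rewrite (cardsD1 x) Vx.
  (* A single vertex spans no edge, which contradicts the density of [V]. *)
  case: eqP => [Vx0|_] /=; last by lia.
  have -> : es (V :\ x) (V :\ x) = 0 by rewrite Vx0 /es big_set0.
  have : dg V x = 0; last by lia.
  rewrite -(setD1K Vx) Vx0 setU0 /dg big_set1 eirr //.
exists V; split=> // [x Vx|]; first by have := bnd x Vx; lia.
by have /set0Pn[x Vx] := V0; have := bnd x Vx; have := degV x Vx; lia.
Qed.

(** * Excess over degree 2 *)

Section Excess.
Variable V : {set T}.
Hypothesis mindeg : forall x, x \in V -> 2 <= dg V x.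

(** By [mindeg] the subtraction is exact on [V]; there [ex x] is positive exactly at the branching
    vertices, those of degree at least 3. *)
Definition ex x : nat := dg V x - 2.
Definition exs A : nat := \sum_(x in A) ex x.
Definition x2 x : nat := \sum_(y in V | e x y) ex y.
Definition br A : nat := #|[set x in A | 0 < ex x]|.

Lemma exs_subset A B : A \subset B -> exs A <= exs B.
Proof.
move=> sAB; rewrite /exs [leqRHS](big_setID A) /= (setIidPr sAB) leq_addr //.
Qed.

Lemma exs_es A : A \subset V -> es A V = exs A + 2 * #|A|.
Proof.
move=> sAV; rewrite /exs /es mulnC -sum_nat_const -big_split /=.
by apply: eq_bigr => x /(subsetP sAV) /mindeg; rewrite /ex => ?; rewrite subnK.
Qed.

Lemma br_subset A B : A \subset B -> br A <= br B.
Proof.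
move=> sAB; apply: subset_leq_card; apply/subsetP=> x.
by rewrite !inE => /andP[/(subsetP sAB)-> ->].
Qed.

Lemma brU A B : br (A :|: B) <= br A + br B.
Proof.
apply: leq_trans (leq_card_setU _ _); apply: subset_leq_card; apply/subsetP=> x.
by rewrite !inE andb_orl.
Qed.

Lemma br1 x : br [set x] = (0 < ex x).
Proof.
case: (boolP (0 < ex x)) => exx; last first.
  by apply/eqP; rewrite cards_eq0; apply/eqP/setP=> y; rewrite !inE; case: eqP => // ->; apply/negbTE.
rewrite -[RHS](cards1 x); apply: eq_card => y; rewrite !inE; case: eqP => // ->.
by rewrite exx.
Qed.

(** * Exploration from a root *)

(** Paths must stay inside [X], so that [br X] bounds the branching vertices of whatever cycle they
    close. *)
Definition rooted v0 X := v0 \in X /\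
  forall x, x \in X -> connect [rel y z | [&& y \in X, z \in X & e y z]] v0 x.

Lemma rooted1 v0 : rooted v0 [set v0].
Proof. by split=> [|x]; rewrite inE // => /eqP->. Qed.

Lemma connect_mono A B x y : A \subset B ->
  connect [rel y z | [&& y \in A, z \in A & e y z]] x y ->
  connect [rel y z | [&& y \in B, z \in B & e y z]] x y.
Proof.
move=> /subsetP sAB; apply: connect_sub => {x y} x y /= /and3P[Ax Ay exy].
by apply: connect1; rewrite /= !sAB.
Qed.

Lemma rootedU v0 A B : rooted v0 A -> rooted v0 B -> rooted v0 (A :|: B).
Proof.
move=> [A0 cA] [B0 cB]; split=> [|x]; first by rewrite inE A0.
rewrite inE => /orP[/cA|/cB]; apply: connect_mono; [exact: subsetUl|exact: subsetUr].
Qed.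

Lemma rootedU1 v0 X a u : rooted v0 X -> a \in X -> e u a -> rooted v0 (u |: X).
Proof.
move=> [X0 cX] Xa ua; split=> [|x]; first by rewrite !inE X0 orbT.
have cX' y : y \in X -> connect [rel y z | [&& y \in u |: X, z \in u |: X & e y z]] v0 y.
  by move=> /cX; apply: connect_mono; apply: subsetUr.
rewrite !inE => /orP[/eqP->|/cX'//]; apply: connect_trans (cX' a Xa) (connect1 _).
by rewrite /= !inE eqxx Xa orbT esym.
Qed.

Lemma rooted_cycle v0 X u a b : rooted v0 X -> u \notin X -> a \in X -> b \in X ->
  a != b -> e u a -> e u b ->
  exists2 s, is_graph_cycle e s & {subset s <= u |: X}.
Proof.
move=> [X0 cX] Xu Xa Xb ab ua ub.
set eX := [rel y z | [&& y \in X, z \in X & e y z]] in cX.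
have symX : symmetric eX by move=> x y /=; rewrite esym andbCA.
have /connectP[p0 p0P p0b] : connect eX a b.
  by apply: connect_trans (cX b Xb); rewrite (sym_connect_sym symX); apply: cX.
move: p0b; case/shortenP: p0P => p pP pU _ bE {p0}.
have sp : all (mem X) p.
  elim: p a Xa pP {pU bE ab ua} => //= y p IH a Xa /andP[/and3P[_ Xy _] pP].
  by rewrite Xy (IH y).
have eP : path e a p by apply: sub_path pP => x y /and3P[].
exists [:: u, a & p]; last first.
  move=> x; rewrite !inE => /orP[->//|/orP[/eqP->|/(allP sp)/= ->]]; by rewrite ?Xa orbT.
apply/and3P; split.
- by case: p bE {pP pU sp eP} => //= abE; rewrite abE eqxx in ab.
- rewrite cons_uniq pU andbT inE negb_or; apply/andP; split.
    by apply: contraNneq Xu => ->.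
  by apply: contraNN Xu => /(allP sp).
- by rewrite /= ua rcons_path eP -bE esym ub.
Qed.

(* The third condition says that [A] spans at most [#|A| - 1] edges; [j] bounds the number of vertices of degree at least 3 on the way from [v0] to any vertex of [A]. *)
Definition grown v0 A j := [/\ v0 \in A, A \subset V, es A A + 2 <= 2 * #|A| &
  forall x, x \in A -> exists X, [/\ X \subset A, x \in X, rooted v0 X & br X <= j]].

Definition no_cheap J := forall s, is_graph_cycle e s -> {subset s <= V} ->
  J < br [set x in s].

Lemma grown1 v0 : v0 \in V -> grown v0 [set v0] 1.
Proof.
move=> V0; split; rewrite ?inE ?sub1set ?cards1 //.
  by rewrite /es big_set1 /dg big_set1 eirr.
move=> x; rewrite inE => /eqP->; exists [set v0]; split; rewrite ?inE //.
  exact: rooted1.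
by rewrite br1 leq_b1.
Qed.

(** Two neighbours of [u] would be joined to [v0] by sets avoiding [u] with at most [j + 1]
    branching vertices each; together with [u] they contain a cycle with at most [2 * j + 3] of
    them. *)
Lemma grown_dg1 v0 A U j J u : no_cheap J -> 2 * j + 3 <= J -> grown v0 A j ->
  U \subset V :\: A -> (forall u, u \in U -> 0 < dg A u) ->
  u \in U -> dg (A :|: U) u <= 1.
Proof.
move=> cheap jJ [_ sAV _ pA] sU nU Uu; rewrite leqNgt; apply/negP.
have [Vu Au] : u \in V /\ u \notin A by have := subsetP sU u Uu; rewrite inE => /andP[].
have path w : w \in A :|: U -> e u w ->
    exists X, [/\ X \subset V, w \in X, u \notin X, rooted v0 X & br X <= j.+1].
  rewrite inE => /orP[Aw|Uw] uw.
    have [X [sX Xw rX bX]] := pA w Aw; exists X; split=> //; last exact: leqW.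
      exact: subset_trans sX sAV.
    by apply: contraNN Au => /(subsetP sX).
  (* A neighbour inside [U] reaches the root through [A], at the price of one more vertex. *)
  have [a Aa wa] := dg_gt0 (nU w Uw); have [X [sX Xa rX bX]] := pA a Aa.
  exists (w |: X); split.
  - rewrite subUset sub1set (subset_trans sX sAV) andbT.
    by have := subsetP sU w Uw; rewrite inE => /andP[].
  - by rewrite !inE eqxx.
  - rewrite !inE negb_or; apply/andP; split.
      by apply: contraTneq uw => <-; rewrite eirr.
    by apply: contraNN Au => /(subsetP sX).
  - exact: rootedU1 wa.
  - by apply: leq_trans (brU _ _) _; rewrite -add1n leq_add // br1 leq_b1.
move=> /dg_gt1[a [b [Ua Ub ab ua ub]]].
have [X [sX Xa Xu rX bX]] := path a Ua ua; have [Y [sY Yb Yu rY bY]] := path b Ub ub.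
have [||||s cs ss] := @rooted_cycle v0 (X :|: Y) u a b _ _ _ _ ab ua ub.
- exact: rootedU.
- by rewrite inE negb_or Xu.
- by rewrite inE Xa.
- by rewrite inE Yb orbT.
have sub : [set x in s] \subset u |: (X :|: Y).
  by apply/subsetP=> x; rewrite inE => /ss.
have sV : {subset s <= V}.
  move=> x /ss; rewrite !inE => /orP[/eqP->//|/orP[/(subsetP sX)|/(subsetP sY)]] //.
have := cheap s cs sV; rewrite ltnNge; apply/negP/negPn.
apply: leq_trans (br_subset sub) _; apply: leq_trans (brU _ _) _.
have b1 : br [set u] <= 1 by rewrite br1 leq_b1.
move: (brU X Y) b1 bX bY jJ.
move: (br _) (br _) (br X) (br Y) => a1 a2 a3 a4; clear; lia.
Qed.

(** By [grown_dg1] each new vertex brings at most one new edge, so the edge bound of a tree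
    survives. *)
Lemma grownU v0 A U j j' J : no_cheap J -> 2 * j + 3 <= J -> grown v0 A j ->
  U \subset V :\: A -> (forall u, u \in U -> 0 < dg A u) ->
  j <= j' -> (forall u, u \in U -> j + (0 < ex u) <= j') -> grown v0 (A :|: U) j'.
Proof.
move=> cheap jJ gA sU nU jj' exU; have [A0 sAV eA pA] := gA.
have dAU : [disjoint A & U] by apply: disjointWr sU (disjD A V).
split.
- by rewrite inE A0.
- by rewrite subUset sAV (subset_trans sU) // subsetDl.
- have le1 : es U (A :|: U) <= #|U|.
    rewrite -sum1_card; apply: leq_sum => u; exact: (grown_dg1 cheap jJ gA sU nU). 
  have eUAU := esUr U dAU; have eAAU := esUr A dAU.
  rewrite esUl // eAAU (esC A U) cardsU.
  have -> : #|A :&: U| = 0 by apply/eqP; rewrite cards_eq0 setI_eq0.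
  lia.
- move=> x; rewrite inE => /orP[Ax|Ux].
    have [X [sX Xx rX bX]] := pA x Ax; exists X; split=> //; last exact: leq_trans jj'.
    exact: subset_trans (subsetUl _ _).
  have [a Aa xa] := dg_gt0 (nU x Ux); have [X [sX Xa rX bX]] := pA a Aa.
  exists (x |: X); split.
  - by rewrite setUC setUSS // sub1set.
  - by rewrite !inE eqxx.
  - exact: rootedU1 xa.
  - apply: leq_trans (brU _ _) _; rewrite br1; have := exU x Ux; lia.
Qed.

(** Absorbing a vertex of degree 2 does not raise [j], so this can go on until the whole boundary
    branches. *)
Lemma grown_saturate v0 A j J : no_cheap J -> 2 * j + 3 <= J -> grown v0 A j ->
  exists B, [/\ A \subset B, grown v0 B j &
    forall u, u \in V :\: B -> 0 < dg B u -> 0 < ex u].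
Proof.
move=> cheap jJ; elim: {A}_.+1 {-2}A (ltnSn #|V :\: A|) => // n IH A leA gA.
case: (boolP [exists u in V :\: A, (0 < dg A u) && (ex u == 0)]) => [|/exists_inPn no].
  move=> /exists_inP[u VAu /andP[Au /eqP exu]].
  case: (IH (A :|: [set u])).
  - by move: leA; rewrite (cardsD1 u) VAu ltnS -setDDl.
  - apply: (grownU cheap jJ gA) => //; first by rewrite sub1set.
      by move=> w; rewrite inE => /eqP->.
    by move=> w; rewrite inE => /eqP->; rewrite exu addn0.
  by move=> B [sB gB mB]; exists B; split=> //; apply: subset_trans sB; apply: subsetUl.
exists A; split=> // u VAu Au; have := no u VAu; rewrite Au /=; lia.
Qed.

(** A saturated tree [A'] has [exs A' + 2 * #|A'|] edge ends but at most [2 * #|A'| - 2] of them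
    inside, so its boundary has at least [exs A' + 2] vertices, each of positive excess. *)
Lemma grown_next v0 A j J : no_cheap J -> 2 * j + 3 <= J -> grown v0 A j ->
  exists B, [/\ grown v0 B j.+1, A :|: [set u in V | 0 < dg A u] \subset B &
    2 * exs A + 2 <= exs B].
Proof.
move=> cheap jJ gA0; have [A' [sA gA mA]] := grown_saturate cheap jJ gA0.
have [A0 sAV eA pA] := gA.
pose U := [set u in V :\: A' | 0 < dg A' u].
have sU : U \subset V :\: A' by apply/subsetP=> u; rewrite inE => /andP[].
have nU u : u \in U -> 0 < dg A' u by rewrite inE => /andP[].
have exU u : u \in U -> 0 < ex u by rewrite inE => /andP[/mA].
have dAU : [disjoint A' & U] by apply: disjointWr sU (disjD A' V).
exists (A' :|: U); split.
- by apply: (grownU cheap jJ gA) => // u _; rewrite -(addn1 j) leq_add2l leq_b1.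
- apply/subsetP=> x; rewrite !inE => /orP[/(subsetP sA)->//|/andP[-> Ax]].
  by case: (x \in A') => //=; apply: leq_trans Ax _; apply: dgS.
(* Each boundary vertex receives only one edge from [A']. *)
have out : es A' V <= es A' A' + #|U|.
  have sA'V : A' \subset V by case: gA.
  rewrite {1}(setUDK sA'V) esUr ?disjD // leq_add2l esC /es -sum1_card.
  rewrite big_mkcond [leqRHS]big_mkcond; apply: leq_sum => u _.
  case: (boolP (u \in U)) => [Uu|]; last first.
    by rewrite inE; case: ifP => //= _; rewrite -eqn0Ngt => /eqP->.
  case: ifP => // _; apply: leq_trans (grown_dg1 cheap jJ gA sU nU Uu).
  by apply: dgS; apply: subsetUl.
have exUU : #|U| <= exs U by rewrite -sum1_card; apply: leq_sum => u; apply: exU.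
have -> : exs (A' :|: U) = exs A' + exs U by rewrite /exs sum_setU.
have := exs_subset sA.
have [_ sA'V eA' _] := gA; have := exs_es sA'V; lia.
Qed.

Lemma x2E v : x2 v = \sum_(u in V) e v u * ex u.
Proof. by rewrite /x2 big_mkcondr; apply: eq_bigr => u _; case: (e v u); rewrite ?mul1n. Qed.

Lemma ex_le_x2 x y : x \in V -> e y x -> ex x <= x2 y.
Proof. by move=> Vx yx; rewrite x2E (bigD1 x) //= yx mul1n leq_addr. Qed.

(** The first step captures the neighbours of [v0], and each of [i] further steps doubles the
    excess. The last step starts with [j = i + 1], whence [2 * i + 5]. *)
Lemma no_cheap_bound v0 i : v0 \in V -> no_cheap (2 * i + 5) ->
  2 ^ i * x2 v0 <= exs V.
Proof.
move=> V0 cheap.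
suff: forall n, n <= i -> exists2 B, grown v0 B n.+2 & 2 ^ n * x2 v0 <= exs B.
  move=> /(_ i (leqnn i))[B [_ sB _ _] le]; exact: leq_trans le (exs_subset sB).
elim=> [_|n IH ni].
  have j1 : 2 * 1 + 3 <= 2 * i + 5 by lia.
  have [B [gB sB _]] := grown_next cheap j1 (grown1 V0); exists B => //.
  rewrite mul1n; apply: leq_trans (exs_subset sB); rewrite /x2 /exs.
  rewrite big_mkcond [leqRHS]big_mkcond; apply: leq_sum => u _.
  rewrite !inE /dg big_set1 (esym u); case: (u \in V) => //=.
  by case: (e v0 u); rewrite ?orbT.
have [B gB dB] := IH (ltnW ni).
have jn : 2 * n.+2 + 3 <= 2 * i + 5 by lia.
have [B' [gB' _ dB']] := grown_next cheap jn gB; exists B' => //.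
rewrite expnS -mulnA; apply: leq_trans dB'; lia.
Qed.

(** Without cycles the exploration never stops, and the excess would outgrow [exs V]. *)
Lemma mindeg2_cycle v0 : v0 \in V ->
  ~ (forall s, is_graph_cycle e s -> ~ {subset s <= V}).
Proof.
move=> V0 acyc; have cheap J : no_cheap J by move=> s /acyc nV /nV.
suff: exists2 B, grown v0 B (exs V).+2 & exs V < exs B.
  by move=> [B [_ sB _ _]]; rewrite ltnNge (exs_subset sB).
elim: (exs V) => [|n [B gB dB]].
  by have [B [gB _ dB]] := grown_next (cheap _) (leqnn _) (grown1 V0); exists B => //; lia.
have [B' [gB' _ dB']] := grown_next (cheap _) (leqnn _) gB; exists B' => //; lia.
Qed.

(** * Few vertices see a large excess *)

(** For [L] heavy vertices, [L * L * D] is at most the sum of their [x2]; overlaps of neighbourhoods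
    add at most [D * (L * (L - 1))] to twice the total excess. *)
Lemma heavy_count L D W :
  (forall x y u v, x != y -> e x u -> e x v -> e y u -> e y v -> u = v) ->
  (forall x, x \in V -> ex x <= D) -> exs V <= W ->
  L <= #|[set v in V | L * D <= x2 v]| -> L * (L + 1) * D <= 2 * W.
Proof.
move=> C4 exD exW /card_geqP[s [us ss sH]]; pose X := [set x in s].
have cX : #|X| = L by rewrite cardsE (card_uniqP us).
have low : L * (L * D) <= \sum_(v in X) x2 v.
  rewrite -{1}cX -sum_nat_const; apply: leq_sum => v; rewrite inE => /sH.
  by rewrite inE => /andP[].
(* Bonferroni: [m <= 1 + m (m - 1) / 2], and [cod u] is [m (m - 1)] for [m = dg X u]. *)
pose cod u := \sum_(x in X) \sum_(y in X | y != x) e u x * e u y.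
have codE u : 2 * dg X u <= 2 + cod u.
  have -> : cod u = dg X u * (dg X u - 1).
    rewrite /cod {1}/dg big_distrl /=; apply: eq_bigr => x Xx.
    rewrite -big_distrr /=; case: (boolP (e u x)) => // ux; rewrite !mul1n.
    by rewrite [dg X u in RHS](bigD1 x) //= ux addKn.
  case: (dg X u) => [|[|m]] //; rewrite subn1 /=; nia.
have sumX : \sum_(v in X) x2 v = \sum_(u in V) dg X u * ex u.
  under eq_bigr do rewrite x2E; rewrite exchange_big /=; apply: eq_bigr => u _.
  by rewrite /dg big_distrl /=; apply: eq_bigr => v _; rewrite esym.
(* Each ordered pair of distinct vertices of [X] has at most one common neighbour. *)
have codS : \sum_(u in V) cod u * ex u <= D * (L * (L - 1)).
  apply: (@leq_trans (D * \sum_(u in V) cod u)).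
    rewrite big_distrr /=; apply: leq_sum => u Vu; rewrite mulnC leq_mul2r exD //.
    by rewrite orbT.
  rewrite leq_mul2l; apply/orP; right; rewrite /cod exchange_big /=.
  rewrite -{1}cX -sum_nat_const; apply: leq_sum => x Xx; rewrite exchange_big /=.
  have -> : L - 1 = \sum_(y in X | y != x) 1.
    rewrite sum1_card -cX (cardsD1 x X) Xx add1n subn1 /=; apply: eq_card => y.
    by rewrite in_setD1 [RHS]unfold_in /= andbC.
  apply: leq_sum => y /andP[_ yx].
  have [ex0|/forall_inPn[u Vu]] := boolP [forall u in V, e u x * e u y == 0].
    by rewrite big1 // => u Vu; apply/eqP; apply: (forall_inP ex0).
  case: (boolP (e u x)) => // ux; case: (boolP (e u y)) => // uy _.
  rewrite (bigD1 u) //= ux uy big1 // => v /andP[_ vu].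
  case: (boolP (e v x)) => // vx; case: (boolP (e v y)) => // vy.
  by move: vu; rewrite (C4 x y v u) ?eqxx // 1?eq_sym // esym.
have : 2 * \sum_(v in X) x2 v <= 2 * W + D * (L * (L - 1)).
  rewrite sumX; apply: (@leq_trans (2 * exs V + \sum_(u in V) cod u * ex u)).
    rewrite !big_distrr /= -big_split /=; apply: leq_sum => u _.
    by rewrite mulnA -mulnDl leq_mul2r codE orbT.
  by apply: leq_add codS; rewrite leq_mul2l.
case: L low {codS sumX cX sH ss} => [|L] low; first by lia.
rewrite subn1 /=; nia.
Qed.

(** * Removing the closed neighbourhood of a cycle *)

Lemma cycle_dg s x : is_graph_cycle e s -> x \in s -> 1 < dg [set y in s] x.
Proof.
move=> /and3P[ss us cs] sx; have [i t rt] := rot_to sx.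
have mem y : (y \in [set y in s]) = (y \in x :: t) by rewrite inE -rt mem_rot.
move: ss us cs; rewrite -(size_rot i) -(rot_uniq i) -(rot_cycle i) rt.
case: t {rt} mem => [|y [|z t]] mem //= _ /and3P[_ yt _].
rewrite rcons_path => /and3P[xy _ /andP[_ zx]].
apply: (@ge2_dg _ x y (last z t)) => //.
- by rewrite mem !inE eqxx orbT.
- by rewrite mem 2!in_cons mem_last !orbT.
- by apply: contraNneq yt => ->; apply: mem_last.
- by rewrite esym.
Qed.

Definition hull A := A :|: [set u in V | 0 < dg A u].

(** A cycle vertex with a neighbour in [V] off the cycle branches, so all excess of the hull sits at
    branching cycle vertices or next to them. For the edges: the cycle has as many as vertices, and
    every other hull vertex adds at least one. *)
Lemma hull_cycle s Q : is_graph_cycle e s -> {subset s <= V} ->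
  (forall v, v \in V -> x2 v <= Q) ->
  exs (hull [set x in s]) <= 2 * Q * br [set x in s] /\
  2 * #|hull [set x in s]| <= es (hull [set x in s]) (hull [set x in s]).
Proof.
move=> cs sV Q2; set Z := [set x in s]; set A := hull Z.
have dZ z : z \in Z -> 1 < dg Z z by rewrite inE => sz; apply: cycle_dg.
have ZV : Z \subset V by apply/subsetP=> x; rewrite inE => /sV.
have AV : A \subset V by rewrite subUset ZV; apply/subsetP=> x; rewrite inE => /andP[].
have ZA : Z \subset A by apply: subsetUl.
split.
- pose B := [set z in Z | 0 < ex z].
  have exQ z : z \in V -> ex z <= Q.
    move=> Vz; have [|y Vy zy] := @dg_gt0 V z; first by have := mindeg Vz; lia.
    by apply: leq_trans (Q2 y Vy); rewrite ex_le_x2 // esym.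
  apply: (@leq_trans (\sum_(u in V) \sum_(z in B) ((u == z) + e z u) * ex u)).
    rewrite /exs [leqRHS](big_setID A) /= (setIidPr AV).
    apply: leq_trans (leq_addr _ _).
    apply: leq_sum => u Au; case: (posnP (ex u)) => [->//|exu].
    have [z Bz zu] : exists2 z, z \in B & (u == z) || e z u.
      move: Au; rewrite in_setU => /orP[Zu|]; first by exists u; rewrite ?eqxx // inE Zu.
      case: (boolP (u \in Z)) => [Zu _|Zu]; first by exists u; rewrite ?eqxx // inE Zu.
      rewrite inE => /andP[Vu /dg_gt0[z Zz uz]]; exists z; last by rewrite esym uz orbT.
      rewrite inE Zz /= subn_gt0; apply: leq_ltn_trans (dZ z Zz) _.
      have sZ : u |: Z \subset V by rewrite subUset sub1set Vu.
      apply: leq_trans (dgS _ sZ); rewrite dgU; last by rewrite disjoints1.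
      by rewrite /dg big_set1 esym uz.
    rewrite (bigD1 z) //=; apply: leq_trans (leq_addr _ _).
    by apply: leq_pmull; case/orP: zu => ->; rewrite ?addn1.
  rewrite exchange_big /= mulnC -sum_nat_const; apply: leq_sum => z.
  rewrite inE => /andP[Zz exz]; have Vz := subsetP ZV z Zz.
  under eq_bigr do rewrite mulnDl; rewrite big_split /= -x2E.
  rewrite mul2n -addnn leq_add ?Q2 // (bigD1 z) //= eqxx mul1n big1 ?addn0 ?exQ //.
  by move=> u /andP[_ /negPf->].
- have dA : [disjoint Z & A :\: Z] := disjD Z A; have EA := setUDK ZA.
  have lZ : 2 * #|Z| <= es Z Z.
    by rewrite mulnC -sum_nat_const; apply: leq_sum => z; apply: dZ.
  have lU : #|A :\: Z| <= es (A :\: Z) Z.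
    rewrite -sum1_card; apply: leq_sum => u.
    by rewrite !inE => /andP[/negPf-> /= /andP[]].
  have -> : es A A = es Z A + es (A :\: Z) A by rewrite {1}EA esUl.
  have -> : es Z A = es Z Z + es Z (A :\: Z) by rewrite {1}EA esUr.
  have := esS (A :\: Z) ZA; rewrite (esC Z (A :\: Z)).
  have : #|A| = #|Z| + #|A :\: Z| by rewrite -(cardsID Z A) (setIidPr ZA).
  lia.
Qed.

(** The cost of a deletion: as [A] spans at least [#|A|] edges, only its excess counts. *)
Lemma es_hull_removed A : A \subset V -> 2 * #|A| <= es A A ->
  es V V + 2 * #|V :\: A| <= es (V :\: A) (V :\: A) + 2 * #|V| + 2 * exs A.
Proof.
move=> sA dA; have := es_remove sA; rewrite (exs_es sA).
have : #|V| = #|A| + #|V :\: A| by rewrite -(cardsID A V) (setIidPr sA).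
lia.
Qed.

End Excess.
Lemma x2_mono A V v : A \subset V -> x2 A v <= x2 V v.
Proof.
move=> sA; rewrite !x2E [leqRHS](big_setID A) /= (setIidPr sA).
apply: leq_trans (leq_addr _ _); apply: leq_sum => u _.
by rewrite leq_mul2l leq_sub2r ?dgS ?orbT.
Qed.

(** * Existence and packing of cycles *)

(** A cycle has at most [#|T|] vertices, so the search is finite. *)
Lemma cycle_dec V : (exists2 s, is_graph_cycle e s & {subset s <= V}) \/
  (forall s, is_graph_cycle e s -> ~ {subset s <= V}).
Proof.
case: (boolP [exists n : 'I_#|T|.+1, [exists t : n.-tuple T,
  is_graph_cycle e t && all (mem V) t]]) => [/existsP[n /existsP[t /andP[ct /allP tV]]]|no].
  by left; exists t.
right=> s cs sV; case/negP: no; apply/existsP.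
have us : uniq s by case/and3P: cs.
have ls : size s < #|T|.+1 by rewrite ltnS -(card_uniqP us) max_card.
exists (Ordinal ls); apply/existsP; exists (in_tuple s); rewrite cs /=.
by apply/allP.
Qed.

Lemma dense_cycle V : V != set0 -> 2 * #|V| <= es V V ->
  exists2 s, is_graph_cycle e s & {subset s <= V}.
Proof.
move=> V0 dV; have [|//|A [/set0Pn[x Ax] sA mA _ _]] := @dense_core V 0 #|V| V0.
- move=> x _; rewrite dgE subset_leq_card //; apply/subsetP=> y.
  by rewrite inE => /andP[].
- by rewrite addn0.
have [[s cs sV]|no] := cycle_dec A; last by case: (mindeg2_cycle mA Ax no).
by exists s => // y /sV /(subsetP sA).
Qed.

(** Indexing by [nat] makes prepending a cycle a mere shift. *)
Definition packs V k := exists c : nat -> seq T,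
  (forall i, i < k -> is_graph_cycle e (c i) /\ {subset c i <= V}) /\
  (forall i j, i < k -> j < k -> i != j ->
     (forall x, x \in c i -> x \notin c j) /\
     (forall x y, x \in c i -> y \in c j -> ~~ e x y)).

Lemma packs_cons V s k : is_graph_cycle e s -> {subset s <= V} ->
  packs (V :\: hull V [set x in s]) k -> packs V k.+1.
Proof.
move=> cs sV [c [cc ic]]; exists (fun i => if i is i'.+1 then c i' else s).
have far i x y : i < k -> x \in s -> y \in c i -> x != y /\ ~~ e x y.
  move=> ik sx cy; have [_ /(_ y cy)] := cc i ik.
  rewrite !inE negb_or => /andP[/andP[sy ny] Vy]; split.
    by apply: contraNneq sy => <-.
  by apply: contraNN ny => xy; rewrite Vy (@dg_edge _ _ x) ?inE // esym.
split=> [[|i]|[|i] [|j]] //.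
- by move=> /cc[? sub]; split=> // x /sub; rewrite inE => /andP[].
- move=> _ jk _; split=> [x sx|x y sx cy]; last by have [] := far j x y jk sx cy.
  by apply/negP => cx; have [/eqP] := far j x x jk sx cx.
- move=> ik _ _; split=> [x cx|x y cx sy]; last by rewrite esym; have [] := far i y x ik sy cx.
  by apply/negP => sx; have [/eqP] := far i x x ik sx cx.
- by move=> ik jk ij; apply: ic.
Qed.

End Counting.

(** * Induction on the number of cycles *)

(** Take [i] minimal: then [2 ^ i.-1 * Q <= W], and [256 * Q <= W] forces [i >= 9], from where
    [2 ^ i.-1] exceeds [16 * i + 40]. *)
Lemma log_room Q W : 0 < Q -> 256 * Q <= W ->
  exists i, W < 2 ^ i * Q /\ 16 * Q * i + 40 * Q <= W.
Proof.
move=> Q0 QW.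
have exi : exists i, W < 2 ^ i * Q.
  by exists W; rewrite (leq_trans (ltn_expl W (isT : 1 < 2))) // leq_pmulr.
case: (ex_minnP exi) => i Wi mini; exists i; split=> //.
have i9 : 9 <= i.
  rewrite leqNgt; apply/negP => i8; have : 2 ^ i <= 2 ^ 8 by rewrite leq_exp2l.
  rewrite -(leq_pmul2r Q0) => ?; have : 2 ^ 8 = 256 by []; lia.
have Wi' : 2 ^ i.-1 * Q <= W.
  by rewrite leqNgt; apply/negP => /mini; lia.
have grow n : 16 * (n + 9) + 40 <= 2 ^ (n + 8).
  by elim: n => // n IH; rewrite addSn (addSn n 8) expnS; lia.
have := grow (i - 9); rewrite subnK //; have -> : i - 9 + 8 = i.-1 by lia.
by rewrite -(leq_pmul2r Q0); lia.
Qed.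

Theorem dense_packs k : exists M, forall (T : finType) (e : rel T),
  symmetric e -> irreflexive e ->
  (forall x y u v, x != y -> e x u -> e x v -> e y u -> e y v -> u = v) ->
  forall (V : {set T}) D, (forall x, x \in V -> dg e V x <= D) ->
  ~ packs e V k -> es e V V <= 2 * #|V| + 2 * M * D.
Proof.
elim: k => [|k [M' IH]].
  by exists 0 => T e _ _ _ V D _ []; exists (fun=> [::]); split=> [] [].
(* With [Q < 4 * p * D] and [W > 8 * p * (p - 1) * D], the 129 yields [256 * Q <= W]; the [M'] makes
   half of [W] exceed [2 * M' * D]. *)
pose p := M' + 129; exists (4 * p * p) => T e esym eirr C4 V D degV nP.
rewrite leqNgt; apply/negP => dV.
have V0 : V != set0 by apply: contraTneq dV => ->; rewrite /es big_set0.
have [|A [/set0Pn[x0 A0] sA mA dA uA]] :=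
  @dense_core _ _ esym eirr V (2 * (4 * p * p) * D).+1 D V0 degV.
  by rewrite addnS.
have degA x : x \in A -> dg e A x <= D.
  by move=> /(subsetP sA) /degV; apply: leq_trans; apply: dgS.
have D2 : 2 <= D := leq_trans (mA x0 A0) (degA x0 A0).
(* Minimality of the core also caps its excess, as [heavy_count] requires. *)
have exA : exs e A A <= 2 * (4 * p * p + 1) * D.
  have := exs_es mA (subxx A); lia.
pose H := [set v in A | 4 * p * D <= x2 e A v].
have Hsmall : #|H| < 4 * p.
  have exD x : x \in A -> ex e A x <= D by move/degA; apply: leq_trans (leq_subr _ _).
  rewrite ltnNge; apply/negP => /(heavy_count esym C4 exD exA).
  have : 129 <= p by rewrite /p leq_addl.
  clearbody p; nia.
have sH : H \subset A by apply/subsetP=> x; rewrite inE => /andP[].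
pose B := A :\: H.
have dB : 2 * #|B| + (8 * p * (p - 1) * D).+1 <= es e B B.
  have := es_remove esym sH; rewrite -/B.
  have : es e H A <= #|H| * D.
    by rewrite -sum_nat_const; apply: leq_sum => x /(subsetP sH); apply: degA.
  have : #|B| <= #|A| by rewrite subset_leq_card // subsetDl.
  have : 129 <= p by rewrite /p leq_addl.
  move: Hsmall dA; move: (es e H A) (es e H H) #|H| => a b h; clearbody p; nia.
have B0 : B != set0 by apply: contraTneq dB => ->; rewrite /es big_set0 addnS.
(* Deleting [H] may leave degrees below 2, so a second core is taken. *)
have [|C [/set0Pn[c0 C0] sC mC dC _]] := @dense_core _ _ esym eirr B _ D B0 _ dB.
  move=> x; rewrite inE => /andP[_ /degA]; apply: leq_trans.
  by apply: dgS; apply: subsetDl.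
have sCA : C \subset A := subset_trans sC (subsetDl _ _).
have sCV : C \subset V := subset_trans sCA sA.
pose v0 := [arg max_(v > c0 in C) x2 e C v]; pose Q := x2 e C v0.
have [Cv0 maxv0] : v0 \in C /\ forall v, v \in C -> x2 e C v <= Q.
  by rewrite /Q /v0; case: arg_maxnP.
(* [v0] survived the deletion of [H], and passing to a subset only lowers [x2]. *)
have QL : Q < 4 * p * D.
  have : v0 \in B := subsetP sC v0 Cv0.
  rewrite !inE => /andP[+ Av0]; rewrite Av0 /= -ltnNge; apply: leq_ltn_trans.
  exact: x2_mono.
pose W := exs e C C; have EW : es e C C = W + 2 * #|C| := exs_es mC (subxx C).
have W0 : 8 * p * (p - 1) * D < W.
  by rewrite -(ltn_add2r (2 * #|C|)) -EW addnC; apply: leq_trans dC; rewrite addnS.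
have Q0 : 0 < Q.
  have [x Cx exx] : exists2 x, x \in C & 0 < ex e C x.
    apply/exists_inP; apply: contraTT (leq_ltn_trans (leq0n _) W0).
    move=> /exists_inPn no; rewrite -eqn0Ngt /W /exs big1 // => x /no.
    by rewrite -eqn0Ngt => /eqP.
  have [|y Cy xy] := @dg_gt0 _ e C x; first by apply: ltnW; apply: mC.
  apply: leq_trans (maxv0 y Cy); apply: leq_trans exx _.
  by apply: ex_le_x2 => //; rewrite esym.
have p129 : M' + 129 <= p by [].
have [|i [Wi room]] := @log_room Q W Q0.
  apply: leq_trans (ltnW W0); move: QL p129; clearbody p Q; clear; nia.
(* A cycle violating [no_cheap] can be split off together with its neighbours. *)
have : no_cheap e C (2 * i + 5); last first.
  by move=> /(no_cheap_bound esym eirr mC Cv0); rewrite leqNgt Wi.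
move=> s cs sV; rewrite ltnNge; apply/negP => brs.
have [exh dh] := hull_cycle esym mC cs sV maxv0.
have sh : hull e C [set x in s] \subset C.
  rewrite subUset; apply/andP; split; apply/subsetP=> x; first by rewrite inE => /sV.
  by rewrite inE => /andP[].
have dE : 2 * #|C :\: hull e C [set x in s]| + 2 * M' * D <
    es e (C :\: hull e C [set x in s]) (C :\: hull e C [set x in s]).
  (* The loss is at most [4 * Q * (2 * i + 5)], half of the bound in [room]. *)
  have := es_hull_removed esym mC sh dh; rewrite EW.
  have : exs e C (hull e C [set x in s]) <= 2 * Q * (2 * i + 5).
    by apply: leq_trans exh _; rewrite leq_mul2l brs orbT.
  move: room W0 p129; clearbody p Q W.
  move: (es _ _ _) #|_| #|C| (exs _ _ _) => a b c d; clear; nia.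
have := IH T e esym eirr C4 _ D _ _; move=> /(_ (C :\: hull e C [set x in s])).
rewrite leqNgt dE => IHE; suff : false by []; apply: IHE.
  move=> x; rewrite inE => /andP[_ /(subsetP sCV) /degV]; apply: leq_trans; apply: dgS.
  exact: subset_trans (subsetDl _ _) sCV.
move=> pk; have [c [cc ic]] := packs_cons esym cs sV pk.
apply: nP; exists c; split=> // j jk; have [? sub] := cc j jk.
by split=> // x /sub /(subsetP sCV).
Qed.

(** * From edge counts to the cycle rank *)

(** The map from ordered pairs to edges has fibres of size 2. *)
Lemma card_edge_set (T : finType) (e : rel T) : symmetric e -> irreflexive e ->
  es e setT setT = 2 * #|edge_set e|.
Proof.
move=> esym eirr; pose f (p : T * T) := [set p.1; p.2].
have -> : edge_set e = f @: [set p | e p.1 p.2].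
  apply/setP=> A; rewrite inE; apply/existsP/imsetP.
    by move=> [x /existsP[y /andP[xy /eqP->]]]; exists (x, y); rewrite ?inE.
  move=> [[x y]]; rewrite inE /= => xy ->; exists x; apply/existsP; exists y.
  by rewrite xy eqxx.
have -> : es e setT setT = \sum_(p in [set p : T * T | e p.1 p.2]) 1.
  rewrite /es /dg; under eq_bigl do rewrite inE.
  under eq_bigr do under eq_bigl do rewrite inE.
  rewrite pair_big /= [RHS]big_mkcond; apply: eq_bigr => p _; rewrite inE.
  by case: (e _ _).
rewrite (partition_big_imset f) /= mulnC -sum_nat_const; apply: eq_bigr => A.
move=> /imsetP[[x y]]; rewrite inE /= => xy ->.
have neq : x != y by apply: contraTneq xy => ->; rewrite eirr.
have -> : 2 = #|[set (x, y); (y, x)]| by rewrite cards2 xpair_eqE negb_and neq.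
rewrite sum1_card; apply: eq_card => -[a b]; rewrite !inE !xpair_eqE /=.
apply/andP/orP => [[ab /eqP E]|]; last first.
  case=> /andP[/eqP-> /eqP->]; rewrite inE /=; first by rewrite xy eqxx.
  by rewrite esym xy /f /= setUC eqxx.
rewrite inE /= in ab.
have nab : a != b by apply: contraTneq ab => ->; rewrite eirr.
have : a \in f (a, b) by rewrite !inE eqxx.
have : b \in f (a, b) by rewrite !inE eqxx orbT.
rewrite E !inE => /orP[] /eqP eb /orP[] /eqP ea; rewrite ea eb ?eqxx ?andbT.
- by rewrite ea eb eqxx in nab.
- by right.
- by left.
- by rewrite ea eb eqxx in nab.
Qed.

(** Parity sharpens [es B B < 2 * #|B|] to a gap of 2, which pays for the component [B] itself. *)
Lemma es_even (T : finType) (e : rel T) (A : {set T}) : symmetric e -> irreflexive e ->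
  exists m, es e A A = 2 * m.
Proof.
move=> esym eirr; pose eA := [rel x y | [&& x \in A, y \in A & e x y]].
exists #|edge_set eA|; rewrite -card_edge_set => [|x y|x]; last by rewrite /= eirr !andbF.
  rewrite /es /dg [LHS]big_mkcond [RHS](eq_bigl xpredT) => [|x]; last by rewrite inE.
  apply: eq_bigr => x _ /=; rewrite [RHS](eq_bigl xpredT) => [|y]; last by rewrite inE.
  case: ifP => Ax; last by rewrite big1.
  by rewrite big_mkcond; apply: eq_bigr => y _; case: ifP.
by rewrite /= esym andbCA.
Qed.

(** An acyclic component has fewer edges than vertices. Each other one contains a cycle, and cycles
    in distinct components are independent, so there are fewer than [k] of these; [dens] is applied
    once, to their union. *)
Lemma cycle_rank_bound (T : finType) (e : rel T) k M D : symmetric e -> irreflexive e ->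
  (forall x, deg e x <= D) -> O_free e k ->
  (forall V : {set T}, es e V V <= 2 * #|V| + 2 * M * D) ->
  #|edge_set e| + #|components e| <= #|T| + (M + k) * D.
Proof.
move=> esym eirr degD free dens; pose cl x := [set y | connect e x y].
have csym : connect_sym e by apply: sym_connect_sym.
have clE B x : B \in components e -> (cl x == B) = (x \in B).
  move=> /imsetP[y _ ->]; apply/eqP/idP => [<-|]; first by rewrite inE.
  rewrite inE => yx; apply/setP=> z; rewrite !inE; apply/idP/idP; apply: connect_trans => //.
  by rewrite csym.
have closed B x y : B \in components e -> x \in B -> e x y -> y \in B.
  by move=> /imsetP[z _ ->]; rewrite !inE => zx /connect1; apply: connect_trans.
have part (P : pred {set T}) (F : T -> nat) :
    \sum_(x | P (cl x)) F x = \sum_(B in components e | P B) \sum_(x in B) F x.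
  rewrite (partition_big cl (fun B => (B \in components e) && P B)) /= => [|x ->].
    apply: eq_bigr => B /andP[Bc PB]; apply: eq_bigl => x; rewrite -(clE B) //.
    by case: eqP => [->|_]; rewrite ?andbF ?PB.
  by rewrite andbT; apply: imset_f.
pose cyc (B : {set T}) := 2 * #|B| <= es e B B.
have cycP B : B \in components e -> cyc B -> exists2 s, is_graph_cycle e s & {subset s <= B}.
  move=> Bc cB; apply: dense_cycle => //; apply/set0Pn.
  by case/imsetP: Bc => x _ ->; exists x; rewrite inE.
have few : #|[set B in components e | cyc B]| < k.
  rewrite ltnNge; apply/negP => /card_geqP[Bs [uB sB inB]]; apply: free.
  pose Bi (i : 'I_k) := nth set0 Bs i.
  have BiP i : Bi i \in [set B in components e | cyc B] by apply/inB/mem_nth; rewrite sB.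
  have /fin_all_exists[c cP] : forall i : 'I_k, exists s,
      is_graph_cycle e s /\ {subset s <= Bi i}.
    move=> i; have := BiP i; rewrite inE => /andP[Bc /(cycP _ Bc)[s cs sub]].
    by exists s.
  exists c; split=> [i|i j ij]; first by case: (cP i).
  have Bc i' : Bi i' \in components e by have := BiP i'; rewrite inE => /andP[].
  have dis x : x \in Bi i -> x \in Bi j -> False.
    rewrite -!clE // => /eqP Ei /eqP Ej; move: ij; rewrite -val_eqE /=.
    by rewrite -(nth_uniq set0 _ _ uB) ?sB // -/(Bi i) -/(Bi j) -Ei -Ej eqxx.
  split=> [x /(proj2 (cP i)) xi|x y /(proj2 (cP i)) xi /(proj2 (cP j)) yj].
    by apply/negP => /(proj2 (cP j)); apply: dis.
  by apply/negP => xy; apply: (dis y) => //; apply: closed xi xy.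
have dgB B x : B \in components e -> x \in B -> dg e setT x = dg e B x.
  move=> Bc xB; rewrite !dgE; apply: eq_card => y; rewrite !inE /=.
  by case xy: (e x y); rewrite ?andbF // (closed B x y).
have cycD : #|[set B in components e | cyc B]| <= k * D.
  (* If [D = 0] there are no edges and hence no cyclic components. *)
  case: (posnP D) => [D0|]; last by move=> /(leq_pmulr k); apply: leq_trans (ltnW few).
  rewrite D0 muln0 leqn0 cards_eq0; apply/eqP/setP=> B; rewrite !inE.
  apply/negP => /andP[Bc]; rewrite /cyc /es big1 => [|x xB].
    rewrite leqn0 muln_eq0 cards_eq0 /= => /eqP B0.
    by case/imsetP: Bc => x _; rewrite B0 => /setP/(_ x); rewrite !inE connect0.
  apply/eqP; rewrite -leqn0 -D0; apply: leq_trans (degD x).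
  by rewrite dgE subset_leq_card //; apply/subsetP=> y; rewrite !inE => /andP[].
have tot : es e setT setT = \sum_(B in components e) es e B B.
  rewrite {1}/es (eq_bigl xpredT) => [|x]; last by rewrite inE.
  rewrite (part xpredT); apply: eq_big => [B|B /andP[Bc _]]; first by rewrite andbT.
  by apply: eq_bigr => x; apply: dgB.
have tT : #|T| = \sum_(B in components e) #|B|.
  rewrite -sum1_card (eq_bigl xpredT) // (part xpredT).
  by apply: eq_big => [B|B _]; rewrite ?andbT ?sum1_card.
pose V := [set x | cyc (cl x)].
have EV : \sum_(B in components e | cyc B) es e B B <= es e V V.
  rewrite {2}/es (eq_bigl (fun x => cyc (cl x))) => [|x]; last by rewrite inE.
  rewrite part; apply: leq_sum => B /andP[Bc cB]; apply: leq_sum => x xB.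
  by apply: dgS; apply/subsetP=> y; rewrite inE -(clE B y Bc) => /eqP->.
have cV : \sum_(B in components e | cyc B) #|B| = #|V|.
  rewrite -[RHS]sum1_card (eq_bigl (fun x => cyc (cl x))) => [|x]; last by rewrite inE.
  by rewrite part; apply: eq_bigr => B _; rewrite sum1_card.
have cc : #|[set B in components e | cyc B]| = \sum_(B in components e | cyc B) 1.
  by rewrite -sum1_card; apply: eq_bigl => B; rewrite inE.
have tree : \sum_(B in components e | ~~ cyc B) (es e B B + 2) <=
    \sum_(B in components e | ~~ cyc B) 2 * #|B|.
  apply: leq_sum => B /andP[_]; rewrite /cyc -ltnNge.
  by have [m ->] := es_even B esym eirr; lia.
have cE : #|components e| = \sum_(B in components e) 1 by rewrite sum1_card.
have := card_edge_set esym eirr; have := dens V.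
move: tot tT cE; rewrite (bigID cyc) [X in #|T| = X](bigID cyc).
rewrite [X in #|components e| = X](bigID cyc) /= -cc cV.
move: tree; rewrite big_split /= -!big_distrr /= => tree tot -> ->.
have E2 (P : pred {set T}) : \sum_(B in components e | P B) 2 =
    2 * \sum_(B in components e | P B) 1 by rewrite big_distrr.
move: tree; rewrite E2 mulnDl -mulnA; move: EV cycD tot.
move: (es e V V) (es e setT setT) #|V| #|edge_set e| (M * D) (k * D) #|_|.
move: (\sum_(i in components e | cyc i) _) (\sum_(i in components e | ~~ cyc i) es e i i).
move: (\sum_(i in components e | ~~ cyc i) 1) (\sum_(i in components e | ~~ cyc i) #|i|).
clear; lia.
Qed.

(** * The degree bound *)

Import Order.TTheory GRing.Theory Num.Theory.
Local Open Scope ring_scope.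

Theorem mainTheorem14 (R : realFieldType) (k : nat) : (1 <= k)%N ->
  exists eps : R, 0 < eps /\
    forall (T : finType) (e : rel T),
      simple_graph e -> (0 < #|T|)%N -> O_free e k -> girth_at_least e 11 ->
      exists x : T, eps * (cycle_rank e)%:~R <= (deg e x)%:R.
Proof.
move=> k1; have [M dense] := dense_packs k.
have K0 : 0 < (M + k)%:R :> R by rewrite ltr0n addn_gt0 k1 orbT.
exists (M + k)%:R^-1; split=> [|T e [esym eirr] /card_gt0P[x0 _] free girth].
  by rewrite invr_gt0.
pose x := [arg max_(y > x0) deg e y]%N; exists x.
have degx y : (deg e y <= deg e x)%N by rewrite /x; case: arg_maxnP => // z _; apply.
(* Two common neighbours would give a 4-cycle, against the girth. *)
have C4 a b u v : a != b -> e a u -> e a v -> e b u -> e b v -> u = v.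
  move=> ab au av bu bv; apply/eqP/idPn => uv.
  have neq y z : e y z -> y != z by move=> yz; apply: contraTneq yz => ->; rewrite eirr.
  suff /girth : is_graph_cycle e [:: a; u; b; v] by [].
  rewrite /is_graph_cycle /= !inE !negb_or ab uv !(neq _ _ au, neq _ _ av) /=.
  by rewrite (neq _ _ bv) eq_sym (neq _ _ bu) au bv (esym u) bu (esym v) av.
have free' V : ~ packs e V k.
  move=> [c [cc ic]]; apply: free; exists (fun i : 'I_k => c i).
  by split=> [i|i j ij]; [case: (cc i)|apply: ic].
have bound : (#|edge_set e| + #|components e| <= #|T| + (M + k) * deg e x)%N.
  apply: cycle_rank_bound => // V; apply: dense => // y _.
  apply: leq_trans (degx y); rewrite dgE subset_leq_card //.
  by apply/subsetP=> z; rewrite !inE => /andP[].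
rewrite mulrC ler_pdivrMr // -natrM mulnC pmulrn ler_int.
rewrite /cycle_rank; lia.
Qed.
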